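(* (i) If $m\ge 3$ and $c=2$, then $\mathrm{N}(L_{m,2})\subset \mathrm{IA}(L_{m,2})$. (ii) If $m\ge 3$ and $c=3$, then $\mathrm{N}(L_{m,3})\subset \mathrm{IA}(L_{m,3})$. (iii) If $m\ge 2$ and $c\ge 4$, then $\mathrm{N}(L_{m,c})\subset \mathrm{IA}(L_{m,c})$.
   Context: $K$ is a field of characteristic $0$. $L_m$ is the free Lie algebra over $K$ with free generators $y_1,\ldots,y_m$, and $L_{m,c}=L_m/(L_m''+L_m^{c+1})$ is the free $m$-generated metabelian nilpotent of class $c$ Lie algebra, where $L_m''=[[L_m,L_m],[L_m,L_m]]$ and $L_m^{k}$ is the $k$-th term of the lower central series ($L_m^1=L_m$). An automorphism $\varphi$ of an algebra $R$ is called normal if $\varphi(I)=I$ for every ideal $I$ of $R$; $\mathrm{N}(R)$ denotes the group of normal automorphisms of $R$. $\mathrm{IA}(L_{m,c})$ is the group of automorphisms of $L_{m,c}$ which induce the identity map modulo the commutator ideal $L_{m,c}'=[L_{m,c},L_{m,c}]$. *)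

(* Defs.v *)
From HB Require Import structures.
From mathcomp Require Import all_boot all_algebra.
From mathcomp Require Import boolp classical_sets.

Set Implicit Arguments.
Unset Strict Implicit.
Unset Printing Implicit Defensive.

Import GRing.Theory.
Local Open Scope ring_scope.
Local Open Scope quotient_scope.
Local Open Scope classical_set_scope.

HB.mixin Record Lmodule_isLie (K : fieldType) L of GRing.Lmodule K L := {
  lie : L -> L -> L;
  lie_linearl : forall (z : L) (a : K) (x y : L),
    lie (a *: x + y) z = a *: lie x z + lie y z;
  lie_linearr : forall (z : L) (a : K) (x y : L),
    lie z (a *: x + y) = a *: lie z x + lie z y;
  liexx : forall x : L, lie x x = 0;
  lie_jacobi : forall x y z : L,
    lie x (lie y z) + lie y (lie z x) + lie z (lie x y) = 0
}.

#[short(type="lieType")]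
HB.structure Definition LieAlgebra (K : fieldType) :=
  {L of Lmodule_isLie K L & GRing.Lmodule K L}.

Section Notions.
Variables (K : fieldType) (L : lieType K).
Implicit Types (A B I : set L) (x y z : L).

Definition subspace A : Prop :=
  A 0 /\ forall (a : K) x y, A x -> A y -> A (a *: x + y).

Definition is_ideal I : Prop :=
  subspace I /\ forall x y, I x -> I (lie x y) /\ I (lie y x).

Definition span A : set L := smallest subspace A.

Definition lie_prod A B : set L :=
  span [set z | exists x y, [/\ A x, B y & z = lie x y]].

Definition derived : set L := lie_prod setT setT.

Definition derived2 : set L := lie_prod derived derived.

(* Indexed so that the first term is the whole algebra; [lcs 0] is a junk value
   equal to [lcs 1]. *)
Definition lcs (k : nat) : set L := iter k.-1 (fun A => lie_prod A setT) setT.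

Definition sumset A B : set L :=
  [set z | exists x y, [/\ A x, B y & z = x + y]].

End Notions.

Arguments derived {K} L _.
Arguments derived2 {K} L _.
Arguments lcs {K} L k _.

Section Automorphisms.
Variables (K : fieldType) (L : lieType K).

Definition automorphism (phi : L -> L) : Prop :=
  [/\ bijective phi,
      forall (a : K) (x y : L), phi (a *: x + y) = a *: phi x + phi y
    & forall x y : L, phi (lie x y) = lie (phi x) (phi y)].

Definition normal_aut : set (L -> L) :=
  [set phi | automorphism phi /\ forall I : set L, is_ideal I -> phi @` I = I].

Definition IA_aut : set (L -> L) :=
  [set phi | automorphism phi /\ forall x : L, derived L (phi x - x)].

End Automorphisms.

Arguments normal_aut {K} L _.
Arguments IA_aut {K} L _.

Section LieTheory.
Variables (K : fieldType) (L : lieType K).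
Implicit Types (A B I J : set L) (x y z : L).

Lemma lieDl x y z : lie (x + y) z = lie x z + lie y z.
Proof. by have := lie_linearl z 1 x y; rewrite !scale1r. Qed.

Lemma lieDr x y z : lie z (x + y) = lie z x + lie z y.
Proof. by have := lie_linearr z 1 x y; rewrite !scale1r. Qed.

Lemma lie0l x : lie 0 x = 0.
Proof. by apply: (addIr (lie 0 x)); rewrite -lieDl !add0r. Qed.

Lemma lie0r x : lie x 0 = 0.
Proof. by apply: (addIr (lie x 0)); rewrite -lieDr !add0r. Qed.

Lemma lieNl x y : lie (- x) y = - lie x y.
Proof.
by have := lie_linearl y (-1) x 0; rewrite !scaleN1r lie0l !addr0.
Qed.

Lemma lieNr x y : lie y (- x) = - lie y x.
Proof.
by have := lie_linearr y (-1) x 0; rewrite !scaleN1r lie0r !addr0.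
Qed.

Lemma lieC x y : lie x y = - lie y x.
Proof.
apply/eqP; rewrite -addr_eq0; apply/eqP.
by have := liexx (x + y); rewrite lieDl !lieDr !liexx add0r addr0.
Qed.

Lemma subspaceN A x : subspace A -> A x -> A (- x).
Proof. by case=> A0 AD Ax; rewrite -[- x]addr0 -scaleN1r; apply: AD. Qed.

Lemma subspaceD A x y : subspace A -> A x -> A y -> A (x + y).
Proof. by case=> A0 AD Ax Ay; rewrite -[x]scale1r; apply: AD. Qed.

Lemma span_subspace A : subspace (span A).
Proof.
split=> [B [[]]//|a x y Ax Ay B [sB AB]].
by apply: sB.2; [apply: Ax | apply: Ay].
Qed.

Lemma is_idealT : is_ideal [set: L].
Proof. by []. Qed.

Lemma lie_prod_ideal I J : is_ideal I -> is_ideal J -> is_ideal (lie_prod I J).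
Proof.
move=> [sI hI] [sJ hJ]; have sIJ := span_subspace
  [set z | exists x y, [/\ I x, J y & z = lie x y]].
have gen x y : I x -> J y -> lie_prod I J (lie x y).
  by move=> Ix Jy B [_]; apply; exists x, y.
split=> // x y Px.
suff H : lie_prod I J (lie x y).
  split; [exact: H | rewrite lieC; exact: (subspaceN sIJ H)].
apply: (Px [set x | lie_prod I J (lie x y)]); split=> [|_ [u [v [Iu Jv ->]]]].
  split=> [|a u v /= Pu Pv]; first by rewrite /= lie0l; apply: sIJ.1.
  by rewrite lie_linearl; apply: sIJ.2.
rewrite /= lieC; apply: (subspaceN sIJ).
have /eqP := lie_jacobi y u v; rewrite -addrA addr_eq0 => /eqP ->.
apply: (subspaceN sIJ); apply: (subspaceD sIJ).
- by apply: gen => //; case: (hJ v y Jv).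
- by rewrite lieC; apply: (subspaceN sIJ); apply: gen => //; case: (hI u y Iu).
Qed.

Lemma derived2_ideal : is_ideal (derived2 L).
Proof. by do 2?apply: lie_prod_ideal; apply: is_idealT. Qed.

Lemma lcs_ideal k : is_ideal (lcs L k).
Proof.
rewrite /lcs; elim: k.-1 => [|n IHn] /=; first exact: is_idealT.
by apply: lie_prod_ideal => //; apply: is_idealT.
Qed.

Lemma sumset_ideal I J : is_ideal I -> is_ideal J -> is_ideal (sumset I J).
Proof.
move=> [sI hI] [sJ hJ]; split; first split.
- by exists 0, 0; split; [exact: sI.1 | exact: sJ.1 | rewrite addr0].
- move=> a _ _ [x [y [Ix Jy ->]]] [x' [y' [Ix' Jy' ->]]].
  exists (a *: x + x'), (a *: y + y').
  by split; [exact: sI.2 | exact: sJ.2 | rewrite scalerDr addrACA].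
move=> _ z [x [y [Ix Jy ->]]]; split.
- exists (lie x z), (lie y z).
  by split; [exact: (hI _ _ Ix).1 | exact: (hJ _ _ Jy).1 | rewrite lieDl].
- exists (lie z x), (lie z y).
  by split; [exact: (hI _ _ Ix).2 | exact: (hJ _ _ Jy).2 | rewrite lieDr].
Qed.

End LieTheory.

Record ideal (K : fieldType) (L : lieType K) :=
  Ideal { ideal_set : set L; idealP : is_ideal ideal_set }.

Section Quotient.
Variables (K : fieldType) (L : lieType K) (I : ideal L).

Definition ideal_pred (x : L) : bool := `[< ideal_set I x >].

Fact ideal_pred_zmod_closed : zmod_closed ideal_pred.
Proof.
have [sI _] := idealP I; split=> [|x y /asboolP Ix /asboolP Iy].
- by apply/asboolP; exact: sI.1.
- by apply/asboolP; apply: subspaceD => //; apply: subspaceN.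
Qed.
HB.instance Definition _ :=
  GRing.isZmodClosed.Build L ideal_pred ideal_pred_zmod_closed.
Definition ideal_zmod : zmodClosed L := GRing.ZmodClosed.clone L ideal_pred _.

Definition lie_quot := Quotient.quot ideal_zmod.
HB.instance Definition _ := GRing.Zmodule.on lie_quot.

Definition lie_quot_pi (x : L) : lie_quot := \pi_(Quotient.quot ideal_zmod) x.

Lemma lie_quot_pi_eq x y :
  lie_quot_pi x = lie_quot_pi y <-> ideal_set I (x - y).
Proof.
rewrite /lie_quot_pi; split.
- by move/eqP; rewrite -Quotient.idealrBE => /asboolP.
- by move=> Ixy; apply/eqP; rewrite -Quotient.idealrBE; apply/asboolP.
Qed.

Lemma lie_quot_piD x y : lie_quot_pi (x + y) = lie_quot_pi x + lie_quot_pi y.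
Proof. by rewrite /lie_quot_pi; exact: (Quotient.pi_add ideal_zmod). Qed.

Definition lie_quot_repr (x : lie_quot) : L := repr (x : Quotient.quot ideal_zmod).

Lemma lie_quot_reprK x : lie_quot_pi (lie_quot_repr x) = x.
Proof. by rewrite /lie_quot_pi /lie_quot_repr reprK. Qed.

Definition lie_quot_scale (a : K) (x : lie_quot) : lie_quot :=
  lie_quot_pi (a *: lie_quot_repr x).

Definition lie_quot_lie (x y : lie_quot) : lie_quot :=
  lie_quot_pi (lie (lie_quot_repr x) (lie_quot_repr y)).

Lemma lie_quot_reprI x : ideal_set I (lie_quot_repr (lie_quot_pi x) - x).
Proof. by apply/lie_quot_pi_eq; rewrite lie_quot_reprK. Qed.

Lemma lie_quot_scale_pi a x :
  lie_quot_scale a (lie_quot_pi x) = lie_quot_pi (a *: x).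
Proof.
apply/lie_quot_pi_eq; rewrite -scalerBr -[_ *: _]addr0.
have [[I0 ID] _] := idealP I.
by apply: ID => //; apply: lie_quot_reprI.
Qed.

Lemma lie_quot_lie_pi x y :
  lie_quot_lie (lie_quot_pi x) (lie_quot_pi y) = lie_quot_pi (lie x y).
Proof.
apply/lie_quot_pi_eq; set x' := lie_quot_repr _; set y' := lie_quot_repr _.
have -> : lie x' y' - lie x y = lie (x' - x) y' + lie x (y' - y).
  by rewrite lieDl lieDr lieNl lieNr addrA subrK.
have [sI hI] := idealP I.
apply: subspaceD => //; first exact: (hI _ _ (lie_quot_reprI x)).1.
exact: (hI _ _ (lie_quot_reprI y)).2.
Qed.

Fact lie_quot_scaleA a b v :
  lie_quot_scale a (lie_quot_scale b v) = lie_quot_scale (a * b) v.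
Proof. by rewrite -[v]lie_quot_reprK !lie_quot_scale_pi scalerA. Qed.

Fact lie_quot_scale1 : left_id 1 lie_quot_scale.
Proof. by move=> v; rewrite -[v]lie_quot_reprK lie_quot_scale_pi scale1r. Qed.

Fact lie_quot_scaleDr : right_distributive lie_quot_scale +%R.
Proof.
move=> a u v; rewrite -[u]lie_quot_reprK -[v]lie_quot_reprK.
by rewrite -lie_quot_piD !lie_quot_scale_pi scalerDr lie_quot_piD.
Qed.

Fact lie_quot_scaleDl v : {morph lie_quot_scale^~ v : a b / a + b}.
Proof.
move=> a b; rewrite -[v]lie_quot_reprK.
by rewrite !lie_quot_scale_pi scalerDl lie_quot_piD.
Qed.

HB.instance Definition _ := GRing.Zmodule_isLmodule.Build K lie_quot
  lie_quot_scaleA lie_quot_scale1 lie_quot_scaleDr lie_quot_scaleDl.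

Lemma lie_quot_piZ a x : lie_quot_pi (a *: x) = a *: lie_quot_pi x.
Proof. by rewrite -lie_quot_scale_pi. Qed.

Fact lie_quot_linearl (z : lie_quot) (a : K) (x y : lie_quot) :
  lie_quot_lie (a *: x + y) z = a *: lie_quot_lie x z + lie_quot_lie y z.
Proof.
rewrite -[x]lie_quot_reprK -[y]lie_quot_reprK -[z]lie_quot_reprK.
rewrite -lie_quot_piZ -lie_quot_piD !lie_quot_lie_pi.
by rewrite -lie_quot_piZ -lie_quot_piD lie_linearl.
Qed.

Fact lie_quot_linearr (z : lie_quot) (a : K) (x y : lie_quot) :
  lie_quot_lie z (a *: x + y) = a *: lie_quot_lie z x + lie_quot_lie z y.
Proof.
rewrite -[x]lie_quot_reprK -[y]lie_quot_reprK -[z]lie_quot_reprK.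
rewrite -lie_quot_piZ -lie_quot_piD !lie_quot_lie_pi.
by rewrite -lie_quot_piZ -lie_quot_piD lie_linearr.
Qed.

Lemma lie_quot_pi0 : lie_quot_pi 0 = 0.
Proof. by apply: (addIr (lie_quot_pi 0)); rewrite -lie_quot_piD !add0r. Qed.

Fact lie_quot_liexx x : lie_quot_lie x x = 0.
Proof.
by rewrite -[x]lie_quot_reprK lie_quot_lie_pi liexx lie_quot_pi0.
Qed.

Fact lie_quot_jacobi (x y z : lie_quot) :
  lie_quot_lie x (lie_quot_lie y z) + lie_quot_lie y (lie_quot_lie z x)
    + lie_quot_lie z (lie_quot_lie x y) = 0.
Proof.
rewrite -[x]lie_quot_reprK -[y]lie_quot_reprK -[z]lie_quot_reprK.
by rewrite !lie_quot_lie_pi -!lie_quot_piD lie_jacobi lie_quot_pi0.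
Qed.

HB.instance Definition _ := Lmodule_isLie.Build K lie_quot
  lie_quot_linearl lie_quot_linearr lie_quot_liexx lie_quot_jacobi.

Lemma lie_quot_pi_lie x y :
  lie_quot_pi (lie x y) = lie (lie_quot_pi x) (lie_quot_pi y).
Proof. by rewrite -lie_quot_lie_pi. Qed.

End Quotient.

(* The free Lie algebra is the term algebra over the generators modulo the
   congruence generated by the Lie algebra axioms over [K]; [freeLie_lift] and
   [freeLie_lift_unique] below give its universal property. *)
Inductive lterm (K : fieldType) (m : nat) : Type :=
| TGen of 'I_m
| TZero
| TOpp of lterm K m
| TAdd of lterm K m & lterm K m
| TScale of K & lterm K m
| TLie of lterm K m & lterm K m.
Arguments TGen {K m}.
Arguments TZero {K m}.

HB.instance Definition _ (K : fieldType) (m : nat) := gen_eqMixin (lterm K m).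
HB.instance Definition _ (K : fieldType) (m : nat) :=
  gen_choiceMixin (lterm K m).

Inductive lterm_eq (K : fieldType) (m : nat) : lterm K m -> lterm K m -> Prop :=
| teq_refl t : lterm_eq t t
| teq_sym s t : lterm_eq s t -> lterm_eq t s
| teq_trans s t u : lterm_eq s t -> lterm_eq t u -> lterm_eq s u
| teq_opp s t : lterm_eq s t -> lterm_eq (TOpp s) (TOpp t)
| teq_add s s' t t' :
    lterm_eq s s' -> lterm_eq t t' -> lterm_eq (TAdd s t) (TAdd s' t')
| teq_scale a s t : lterm_eq s t -> lterm_eq (TScale a s) (TScale a t)
| teq_lie s s' t t' :
    lterm_eq s s' -> lterm_eq t t' -> lterm_eq (TLie s t) (TLie s' t')
| teq_addA s t u : lterm_eq (TAdd s (TAdd t u)) (TAdd (TAdd s t) u)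
| teq_addC s t : lterm_eq (TAdd s t) (TAdd t s)
| teq_add0 s : lterm_eq (TAdd TZero s) s
| teq_addN s : lterm_eq (TAdd (TOpp s) s) TZero
| teq_scaleA a b s : lterm_eq (TScale a (TScale b s)) (TScale (a * b) s)
| teq_scale1 s : lterm_eq (TScale 1 s) s
| teq_scaleDr a s t :
    lterm_eq (TScale a (TAdd s t)) (TAdd (TScale a s) (TScale a t))
| teq_scaleDl a b s :
    lterm_eq (TScale (a + b) s) (TAdd (TScale a s) (TScale b s))
| teq_liel a s t u :
    lterm_eq (TLie (TAdd (TScale a s) t) u)
             (TAdd (TScale a (TLie s u)) (TLie t u))
| teq_lier a s t u :
    lterm_eq (TLie u (TAdd (TScale a s) t))
             (TAdd (TScale a (TLie u s)) (TLie u t))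
| teq_liexx s : lterm_eq (TLie s s) TZero
| teq_jacobi s t u :
    lterm_eq (TAdd (TAdd (TLie s (TLie t u)) (TLie t (TLie u s)))
                   (TLie u (TLie s t))) TZero.

Section FreeLie.
Variables (K : fieldType) (m : nat).

Definition lterm_eqb (s t : lterm K m) : bool := `[< lterm_eq s t >].

Fact lterm_eqb_equiv : equiv_class_of lterm_eqb.
Proof.
split=> [s|s t|t s u].
- by apply/asboolP; exact: teq_refl.
- by apply/asboolP/asboolP; exact: teq_sym.
- by move=> /asboolP st /asboolP tu; apply/asboolP; exact: teq_trans st tu.
Qed.
Canonical lterm_eqb_equiv_rel := EquivRelPack lterm_eqb_equiv.

Definition freeLie := {eq_quot lterm_eqb}.
HB.instance Definition _ := Choice.on freeLie.

Definition fl_class (t : lterm K m) : freeLie := \pi_({eq_quot lterm_eqb}) t.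
Definition fl_repr (x : freeLie) : lterm K m :=
  repr (x : {eq_quot lterm_eqb}).

Lemma fl_reprK x : fl_class (fl_repr x) = x.
Proof. exact: reprK. Qed.

Lemma fl_class_eq s t : fl_class s = fl_class t <-> lterm_eq s t.
Proof.
split=> [/eqP|st]; first by rewrite eqmodE => /asboolP.
by apply/eqP; rewrite eqmodE; apply/asboolP.
Qed.

Lemma fl_repr_eq t : lterm_eq (fl_repr (fl_class t)) t.
Proof. by apply/fl_class_eq; rewrite fl_reprK. Qed.

Definition fl_gen (i : 'I_m) : freeLie := fl_class (TGen i).
Definition fl_zero : freeLie := fl_class TZero.
Definition fl_opp (x : freeLie) : freeLie := fl_class (TOpp (fl_repr x)).
Definition fl_add (x y : freeLie) : freeLie :=
  fl_class (TAdd (fl_repr x) (fl_repr y)).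
Definition fl_scale (a : K) (x : freeLie) : freeLie :=
  fl_class (TScale a (fl_repr x)).
Definition fl_lie (x y : freeLie) : freeLie :=
  fl_class (TLie (fl_repr x) (fl_repr y)).

Lemma fl_oppE s : fl_opp (fl_class s) = fl_class (TOpp s).
Proof. by apply/fl_class_eq/teq_opp/fl_repr_eq. Qed.

Lemma fl_addE s t : fl_add (fl_class s) (fl_class t) = fl_class (TAdd s t).
Proof. by apply/fl_class_eq/teq_add; apply: fl_repr_eq. Qed.

Lemma fl_scaleE a s : fl_scale a (fl_class s) = fl_class (TScale a s).
Proof. by apply/fl_class_eq/teq_scale/fl_repr_eq. Qed.

Lemma fl_lieE s t : fl_lie (fl_class s) (fl_class t) = fl_class (TLie s t).
Proof. by apply/fl_class_eq/teq_lie; apply: fl_repr_eq. Qed.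

Lemma fl_ind (P : freeLie -> Prop) : (forall t, P (fl_class t)) -> forall x, P x.
Proof. by move=> H x; rewrite -[x]fl_reprK. Qed.

Let flE := (fl_oppE, fl_addE, fl_scaleE, fl_lieE).

Fact fl_addA : associative fl_add.
Proof.
elim/fl_ind=> s; elim/fl_ind=> t; elim/fl_ind=> u.
by rewrite !flE; apply/fl_class_eq/teq_addA.
Qed.

Fact fl_addC : commutative fl_add.
Proof.
by elim/fl_ind=> s; elim/fl_ind=> t; rewrite !flE; apply/fl_class_eq/teq_addC.
Qed.

Fact fl_add0 : left_id fl_zero fl_add.
Proof. by elim/fl_ind=> s; rewrite !flE; apply/fl_class_eq/teq_add0. Qed.

Fact fl_addN : left_inverse fl_zero fl_opp fl_add.
Proof. by elim/fl_ind=> s; rewrite !flE; apply/fl_class_eq/teq_addN. Qed.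

HB.instance Definition _ :=
  GRing.isZmodule.Build freeLie fl_addA fl_addC fl_add0 fl_addN.

Fact fl_scaleA a b v : fl_scale a (fl_scale b v) = fl_scale (a * b) v.
Proof.
by elim/fl_ind: v => s; rewrite !flE; apply/fl_class_eq/teq_scaleA.
Qed.

Fact fl_scale1 : left_id 1 fl_scale.
Proof. by elim/fl_ind=> s; rewrite !flE; apply/fl_class_eq/teq_scale1. Qed.

Fact fl_scaleDr : right_distributive fl_scale fl_add.
Proof.
move=> a; elim/fl_ind=> s; elim/fl_ind=> t.
by rewrite !flE; apply/fl_class_eq/teq_scaleDr.
Qed.

Fact fl_scaleDl v (a b : K) :
  fl_scale (a + b) v = fl_add (fl_scale a v) (fl_scale b v).
Proof.
by elim/fl_ind: v => s; rewrite !flE; apply/fl_class_eq/teq_scaleDl.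
Qed.

HB.instance Definition _ := GRing.Zmodule_isLmodule.Build K freeLie
  fl_scaleA fl_scale1 fl_scaleDr fl_scaleDl.

Fact fl_linearl z a x y :
  fl_lie (fl_add (fl_scale a x) y) z
  = fl_add (fl_scale a (fl_lie x z)) (fl_lie y z).
Proof.
elim/fl_ind: x => s; elim/fl_ind: y => t; elim/fl_ind: z => u.
by rewrite !flE; apply/fl_class_eq/teq_liel.
Qed.

Fact fl_linearr z a x y :
  fl_lie z (fl_add (fl_scale a x) y)
  = fl_add (fl_scale a (fl_lie z x)) (fl_lie z y).
Proof.
elim/fl_ind: x => s; elim/fl_ind: y => t; elim/fl_ind: z => u.
by rewrite !flE; apply/fl_class_eq/teq_lier.
Qed.

Fact fl_liexx x : fl_lie x x = fl_zero.
Proof. by elim/fl_ind: x => s; rewrite !flE; apply/fl_class_eq/teq_liexx. Qed.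

Fact fl_jacobi x y z :
  fl_add (fl_add (fl_lie x (fl_lie y z)) (fl_lie y (fl_lie z x)))
         (fl_lie z (fl_lie x y)) = fl_zero.
Proof.
elim/fl_ind: x => s; elim/fl_ind: y => t; elim/fl_ind: z => u.
by rewrite !flE; apply/fl_class_eq/teq_jacobi.
Qed.

HB.instance Definition _ := Lmodule_isLie.Build K freeLie
  fl_linearl fl_linearr fl_liexx fl_jacobi.

End FreeLie.

Section Universal.
Variables (K : fieldType) (m : nat) (M : lieType K).

Definition lie_hom (L : lieType K) (f : L -> M) : Prop :=
  (forall (a : K) (x y : L), f (a *: x + y) = a *: f x + f y) /\
  (forall x y : L, f (lie x y) = lie (f x) (f y)).

Fixpoint lterm_eval (g : 'I_m -> M) (t : lterm K m) : M :=
  match t with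
  | TGen i => g i
  | TZero => 0
  | TOpp s => - lterm_eval g s
  | TAdd s u => lterm_eval g s + lterm_eval g u
  | TScale a s => a *: lterm_eval g s
  | TLie s u => lie (lterm_eval g s) (lterm_eval g u)
  end.

Lemma lterm_eval_eq g s t :
  lterm_eq s t -> lterm_eval g s = lterm_eval g t.
Proof.
elim=> {s t} /=; try by move=> *; congruence.
- by move=> *; rewrite addrA.
- by move=> *; rewrite addrC.
- by move=> *; rewrite add0r.
- by move=> *; rewrite addNr.
- by move=> *; rewrite scalerA.
- by move=> *; rewrite scale1r.
- by move=> *; rewrite scalerDr.
- by move=> *; rewrite scalerDl.
- by move=> *; rewrite lie_linearl.
- by move=> *; rewrite lie_linearr.
- by move=> *; rewrite liexx.
- by move=> *; rewrite lie_jacobi.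
Qed.

Definition freeLie_lift (g : 'I_m -> M) (x : freeLie K m) : M :=
  lterm_eval g (fl_repr x).

Lemma freeLie_lift_class g t : freeLie_lift g (fl_class t) = lterm_eval g t.
Proof. exact/lterm_eval_eq/fl_repr_eq. Qed.

Lemma freeLie_lift_gen g i : freeLie_lift g (fl_gen K i) = g i.
Proof. exact: freeLie_lift_class. Qed.

Lemma freeLie_lift_hom g : lie_hom (freeLie_lift g).
Proof.
split=> [a|]; elim/fl_ind=> s; elim/fl_ind=> t.
- have -> : a *: fl_class s + fl_class t = fl_class (TAdd (TScale a s) t).
    by rewrite -fl_addE -fl_scaleE.
  by rewrite !freeLie_lift_class.
- have -> : lie (fl_class s) (fl_class t) = fl_class (TLie s t).
    by rewrite -fl_lieE.
  by rewrite !freeLie_lift_class.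
Qed.

Lemma freeLie_lift_unique g (f : freeLie K m -> M) :
  lie_hom f -> (forall i, f (fl_gen K i) = g i) -> f =1 freeLie_lift g.
Proof.
move=> [fL fB] fg; elim/fl_ind=> t; rewrite freeLie_lift_class.
have fD x y : f (x + y) = f x + f y by rewrite -[x]scale1r fL !scale1r.
have f0 : f 0 = 0 by apply: (addIr (f 0)); rewrite -fD !add0r.
have fZ a x : f (a *: x) = a *: f x by rewrite -[a *: x]addr0 fL f0 addr0.
elim: t => [i||s IH|s IHs t IHt|a s IH|s IHs t IHt] /=.
- exact: fg.
- exact: f0.
- rewrite -fl_oppE -IH; apply: (addIr (f (fl_class s))).
  by rewrite -fD (addNr (fl_class s)) addNr f0.
- by rewrite -fl_addE -IHs -IHt -fD.
- by rewrite -fl_scaleE -IH -fZ.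
- by rewrite -fl_lieE -IHs -IHt -fB.
Qed.

End Universal.

Definition freeLieAlg (K : fieldType) (m : nat) : lieType K :=
  LieAlgebra.clone K (freeLie K m) _.

Definition metab_nilp_ideal (K : fieldType) (m c : nat) :
    ideal (freeLieAlg K m) :=
  Ideal (sumset_ideal (derived2_ideal (freeLieAlg K m))
                      (lcs_ideal (freeLieAlg K m) c.+1)).

Definition freeMetabNilp (K : fieldType) (m c : nat) : lieType K :=
  LieAlgebra.clone K (lie_quot (metab_nilp_ideal K m c)) _.

(* Main.v *)
Require Import Defs.
From HB Require Import structures.
From mathcomp Require Import all_boot all_algebra.
From mathcomp Require Import boolp classical_sets.
From mathcomp Require Import ring.
Local Open Scope ring_scope.
Local Open Scope classical_set_scope.

(** Let [phi] be a normal automorphism of [L = freeMetabNilp K m c].  For each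
    [x] the set [K x + L'] is an ideal, so [phi x] lies in [K x + L']; when
    there are at least two generators, comparing [y_i], [y_j] and [y_i + y_j]
    shows that [phi] acts on [L / L'] as a single nonzero scalar [a]
    ([normal_aut_scalar], [scalar_neq0]).  It remains to see that [a = 1].

    The idea is that [phi] multiplies degree [k] by [a ^+ k] up to higher
    degrees, so that an ideal containing a sum of two terms of different
    degrees, but neither term, tends to force two powers of [a] to coincide.
    The ideals are kernels of homomorphisms from [L] to small Lie algebras,
    which exist because [L] is free among the metabelian algebras that are
    nilpotent of class at most [c] ([freeMetabNilp_lift]).  Write (u, v) for
    the Lie bracket.
    - With three generators and [c >= 2], take the Heisenberg algebra on [x],
      [y] and the central element [w = (x, y)].  The map sending [y_0], [y_1],
      [y_2] to [- w], [x], [y] kills [y_0 + (y_1, y_2)].  After [phi], the two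
      terms are sent to [- a w + u] and [a ^+ 2 w], where [u] is the image of
      the part of [phi y_0] in [L'].  The map sending [y_0] to [0] instead has
      [y_0] in its kernel and agrees with the first one on [L'], so normality
      for that kernel gives [u = 0].  Hence [a ^+ 2 = a] ([scalar_eq1_3gen]).
    - With two generators and [c >= 4], take the algebra with basis [x], [y],
      [w], [s], [t] and nonzero brackets [(x, y) = w], [(w, y) = s],
      [(s, y) = t], [(w, x) = - t].  The map sending [y_0], [y_1] to [x], [y]
      kills [((y_0, y_1), y_0) + (((y_0, y_1), y_1), y_1)].  The image of this
      element under [phi] is sent to [(a ^+ 4 - a ^+ 3) t]: the parts of
      [phi y_0] and [phi y_1] in [L'] contribute nothing, since brackets of
      elements of [L'] vanish and a correction to [(y_0, y_1)] is a combination
      of [s] and [t], which [x] annihilates and [y] annihilates after two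
      steps.  Hence [a ^+ 4 = a ^+ 3] ([scalar_eq1_2gen]). *)

Set Implicit Arguments.
Unset Strict Implicit.
Unset Printing Implicit Defensive.

Import GRing.Theory.

(** * Homomorphisms, kernels and products of subspaces *)

Section Generalities.
Variables (K : fieldType) (L M : lieType K) (f : L -> M).
Hypothesis hf : lie_hom f.

Lemma lie_homD x y : f (x + y) = f x + f y.
Proof. by rewrite -[x]scale1r hf.1 !scale1r. Qed.

Lemma lie_hom0 : f 0 = 0.
Proof. by apply: (addIr (f 0)); rewrite -lie_homD !add0r. Qed.

Lemma lie_homZ a x : f (a *: x) = a *: f x.
Proof. by rewrite -[a *: x]addr0 hf.1 lie_hom0 addr0. Qed.

Lemma lie_homB x y : f (x - y) = f x - f y.
Proof. by rewrite lie_homD -scaleN1r lie_homZ scaleN1r. Qed.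

Lemma lie_hom_lie x y : f (lie x y) = lie (f x) (f y).
Proof. exact: hf.2. Qed.

Lemma ker_ideal : is_ideal [set x | f x = 0].
Proof.
split; first split=> [|a x y /= fx fy]; first exact: lie_hom0.
  by rewrite hf.1 fx fy scaler0 addr0.
by move=> x y /= fx; rewrite !lie_hom_lie fx lie0l lie0r.
Qed.

Lemma preimage_subspace (A : set M) : subspace A -> subspace (f @^-1` A).
Proof.
by move=> [A0 AD]; split=> [|a x y]; rewrite /preimage /= ?lie_hom0 ?hf.1; auto.
Qed.

Lemma lie_prod_min (A B C : set L) : subspace C ->
  (forall x y, A x -> B y -> C (lie x y)) -> lie_prod A B `<=` C.
Proof.
by move=> sC H z; apply; split=> // _ [x [y [Ax By ->]]]; apply: H.
Qed.

Lemma derived_subspace : subspace (derived L).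
Proof. exact: span_subspace. Qed.

Lemma derived_lie (x y : L) : derived L (lie x y).
Proof. by move=> B [_]; apply; exists x, y. Qed.

End Generalities.

Section Functoriality.
Variables (K : fieldType) (L M : lieType K) (f : L -> M).
Hypothesis hf : lie_hom f.

Lemma lie_hom_prod (A B : set L) (A' B' : set M) :
  A `<=` f @^-1` A' -> B `<=` f @^-1` B' ->
  lie_prod A B `<=` f @^-1` lie_prod A' B'.
Proof.
move=> AA' BB'; apply: lie_prod_min => [|x y Ax By].
  exact/preimage_subspace/span_subspace.
by rewrite /preimage /= lie_hom_lie // => C [_]; apply; exists (f x), (f y);
  split=> //; [exact: AA' | exact: BB'].
Qed.

Lemma lie_hom_derived2 : derived2 L `<=` f @^-1` derived2 M.
Proof. by do 2?apply: lie_hom_prod. Qed.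

Lemma lie_hom_lcs k : lcs L k `<=` f @^-1` lcs M k.
Proof.
by rewrite /lcs; elim: k.-1 => [|n IHn] //=; apply: lie_hom_prod.
Qed.

End Functoriality.

Lemma automorphism_hom (K : fieldType) (L : lieType K) (phi : L -> L) :
  automorphism phi -> lie_hom phi.
Proof. by case. Qed.

Lemma normal_aut_mem (K : fieldType) (L : lieType K) (phi : L -> L)
    (I : set L) x :
  normal_aut L phi -> is_ideal I -> I x -> I (phi x).
Proof. by move=> [_ nphi] hI Ix; rewrite -(nphi I hI); exists x. Qed.

(** * The universal property of the free metabelian nilpotent algebra *)

Section FreeMetabNilp.
Variables (K : fieldType) (m c : nat).
Notation F := (freeMetabNilp K m c).

Definition fmn_gen (i : 'I_m) : F :=
  lie_quot_pi (metab_nilp_ideal K m c) (fl_gen K i).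

(** Every element is a combination of generators modulo [L'], so a property
    that depends only on the class modulo [L'] and is linear can be checked on
    the generators alone. *)
Lemma freeMetabNilp_span (S : set F) :
  subspace S -> derived F `<=` S -> (forall i, S (fmn_gen i)) -> forall x, S x.
Proof.
move=> sS dS gS x; rewrite -[x]lie_quot_reprK -[lie_quot_repr x]fl_reprK.
elim: (fl_repr (lie_quot_repr x)) => {x}
  [i||s IH|s IHs t IHt|a s IH|s IHs t IHt].
- exact: gS.
- by rewrite -[fl_class _]/(0 : freeLieAlg K m) lie_quot_pi0; exact: sS.1.
- have -> : fl_class (TOpp s) = (-1) *: (fl_class s : freeLieAlg K m).
    by rewrite scaleN1r -fl_oppE.
  by rewrite lie_quot_piZ scaleN1r; apply: subspaceN.
- have -> : fl_class (TAdd s t) = (fl_class s : freeLieAlg K m) + fl_class t.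
    by rewrite -fl_addE.
  by rewrite lie_quot_piD; apply: subspaceD.
- have -> : fl_class (TScale a s) = a *: (fl_class s : freeLieAlg K m).
    by rewrite -fl_scaleE.
  by rewrite lie_quot_piZ -[_ *: _]addr0; apply: sS.2 => //; apply: sS.1.
- have -> : fl_class (TLie s t) =
      lie (fl_class s : freeLieAlg K m) (fl_class t).
    by rewrite -fl_lieE.
  by rewrite lie_quot_pi_lie; apply: dS; apply: derived_lie.
Qed.

Lemma freeMetabNilp_lift (M : lieType K) (g : 'I_m -> M) :
  derived2 M `<=` [set 0] -> lcs M c.+1 `<=` [set 0] ->
  exists2 f : F -> M, lie_hom f & forall i, f (fmn_gen i) = g i.
Proof.
move=> M2 Mc; pose h : freeLieAlg K m -> M := freeLie_lift g.
have hh : lie_hom h by exact: freeLie_lift_hom.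
pose f (x : F) : M := h (lie_quot_repr x).
have fpi x : f (lie_quot_pi _ x) = h x.
  apply/eqP; rewrite -subr_eq0 /f -lie_homB //; apply/eqP.
  have [u [v [Du Lv ->]]] := lie_quot_reprI (metab_nilp_ideal K m c) x.
  rewrite lie_homD // (M2 _ (lie_hom_derived2 hh Du)).
  by rewrite (Mc _ (lie_hom_lcs hh Lv)) addr0.
exists f; last by move=> i; rewrite fpi; exact: freeLie_lift_gen.
split=> [a x y|x y]; rewrite -[x]lie_quot_reprK -[y]lie_quot_reprK.
  by rewrite -lie_quot_piZ -lie_quot_piD !fpi hh.1.
by rewrite -lie_quot_pi_lie !fpi hh.2.
Qed.

End FreeMetabNilp.

(** * The test algebras *)

(** For [e = 1] this is the five-dimensional algebra of class four with basis
    [x], [y], [w], [s], [t] and brackets (x, y) = w, (w, y) = s, (s, y) = t,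
    (w, x) = - t; for [e = 0] the brackets of degree three and four vanish,
    leaving the Heisenberg algebra on [x], [y], [w] plus a central plane.  The
    parameter lets one verification of the Lie axioms serve both. *)
Definition testAlg (K : fieldType) (e : K) : Type := 'rV[K]_5.

Section TestAlgebra.
Variables (K : fieldType) (e : K).
Notation T := (testAlg e).

HB.instance Definition _ := GRing.Lmodule.copy T 'rV[K]_5.

Definition test_lie (u v : T) : T := \row_(k < 5) [::
  0; 0;
  u 0 0 * v 0 1 - u 0 1 * v 0 0;
  e * (u 0 2 * v 0 1 - u 0 1 * v 0 2);
  e * (u 0 3 * v 0 1 - u 0 1 * v 0 3 - (u 0 2 * v 0 0 - u 0 0 * v 0 2))]`_k.

Lemma testP (u v : T) : u 0 0 = v 0 0 -> u 0 1 = v 0 1 -> u 0 2 = v 0 2 ->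
  u 0 3 = v 0 3 -> u 0 4 = v 0 4 -> u = v.
Proof.
move=> h0 h1 h2 h3 h4; apply/rowP; case=> -[|[|[|[|[|//]]]]] lt.
- by rewrite (_ : Ordinal lt = 0) //; apply: val_inj.
- by rewrite (_ : Ordinal lt = 1) //; apply: val_inj.
- by rewrite (_ : Ordinal lt = 2) //; apply: val_inj.
- by rewrite (_ : Ordinal lt = 3) //; apply: val_inj.
- by rewrite (_ : Ordinal lt = 4) //; apply: val_inj.
Qed.

Lemma testD (u v : T) i j : (u + v) i j = u i j + v i j.
Proof. exact: mxE. Qed.

Lemma testZ (a : K) (u : T) i j : (a *: u) i j = a * u i j.
Proof. exact: mxE. Qed.

Lemma test0 i j : (0 : T) i j = 0.
Proof. exact: mxE. Qed.

Lemma testN (u : T) i j : (- u) i j = - u i j.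
Proof. exact: mxE. Qed.

Definition testE := (testD, testZ, test0, testN).

Lemma test_lieE0 u v : test_lie u v 0 0 = 0. Proof. by rewrite mxE. Qed.
Lemma test_lieE1 u v : test_lie u v 0 1 = 0. Proof. by rewrite mxE. Qed.
Lemma test_lieE2 u v :
  test_lie u v 0 2 = u 0 0 * v 0 1 - u 0 1 * v 0 0.
Proof. by rewrite mxE. Qed.
Lemma test_lieE3 u v :
  test_lie u v 0 3 = e * (u 0 2 * v 0 1 - u 0 1 * v 0 2).
Proof. by rewrite mxE. Qed.
Lemma test_lieE4 u v : test_lie u v 0 4 =
  e * (u 0 3 * v 0 1 - u 0 1 * v 0 3 - (u 0 2 * v 0 0 - u 0 0 * v 0 2)).
Proof. by rewrite mxE. Qed.

Definition test_lie_rawE :=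
  (test_lieE0, test_lieE1, test_lieE2, test_lieE3, test_lieE4).

Fact test_linearl (z : T) (a : K) (x y : T) :
  test_lie (a *: x + y) z = a *: test_lie x z + test_lie y z.
Proof. by apply: testP; rewrite ?testE ?test_lie_rawE ?testE; ring. Qed.

Fact test_linearr (z : T) (a : K) (x y : T) :
  test_lie z (a *: x + y) = a *: test_lie z x + test_lie z y.
Proof. by apply: testP; rewrite ?testE ?test_lie_rawE ?testE; ring. Qed.

Fact test_liexx (x : T) : test_lie x x = 0.
Proof. by apply: testP; rewrite ?testE ?test_lie_rawE ?testE; ring. Qed.

Fact test_jacobi (x y z : T) :
  test_lie x (test_lie y z) + test_lie y (test_lie z x)
    + test_lie z (test_lie x y) = 0.
Proof. by apply: testP; rewrite ?testE ?test_lie_rawE; ring. Qed.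

HB.instance Definition _ := Lmodule_isLie.Build K T
  test_linearl test_linearr test_liexx test_jacobi.

Lemma test_lieE (u v : T) : lie u v = test_lie u v.
Proof. by []. Qed.

End TestAlgebra.

Lemma lcs_eq0_le (K : fieldType) (L : lieType K) k n : (k <= n)%N ->
  lcs L k.+1 `<=` [set 0] -> lcs L n.+1 `<=` [set 0].
Proof.
move=> /subnK <-; elim: (n - k)%N => [//|j IHj] Lk.
apply: lie_prod_min => [|x y /(IHj Lk) -> _]; last exact: lie0l.
by split=> [|a x y -> ->] //; rewrite /= scaler0 addr0.
Qed.

Section TestAlgebraSeries.
Variables (K : fieldType) (e : K).
Notation T := (testAlg e).

Lemma test_derived (u : T) : derived T u -> u 0 0 = 0 /\ u 0 1 = 0.
Proof.
move: u; apply: (@lie_prod_min _ _ _ _ [set u : T | u 0 0 = 0 /\ u 0 1 = 0]).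
  split=> [|a x y /= [x0 x1] [y0 y1]]; first by rewrite /= !testE.
  by rewrite !testE x0 x1 y0 y1 mulr0 addr0.
by move=> x y _ _; rewrite /= test_lieE !test_lie_rawE.
Qed.

Lemma test_derived2 : derived2 T `<=` [set 0].
Proof.
apply: lie_prod_min => [|x y /test_derived [x0 x1] /test_derived [y0 y1]].
  by split=> [|a x y -> ->] //; rewrite /= scaler0 addr0.
rewrite /= test_lieE; apply: testP;
  by rewrite !test_lie_rawE ?testE ?x0 ?x1 ?y0 ?y1; ring.
Qed.

(** Each further bracket raises the degree, killing one more of the coordinates
    along [w], [s], [t]. *)
Lemma test_lcs5 : lcs T 5 `<=` [set 0].
Proof.
have L3 : lcs T 3 `<=` [set u : T | [/\ u 0 0 = 0, u 0 1 = 0 & u 0 2 = 0]].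
  apply: lie_prod_min => [|x y /test_derived [x0 x1] _].
    split=> [|a x y /= [x0 x1 x2] [y0 y1 y2]]; first by rewrite /= !testE.
    by rewrite !testE x0 x1 x2 y0 y1 y2 mulr0 addr0.
  by rewrite /= test_lieE !test_lie_rawE x0 x1; split=> //; ring.
have L4 : lcs T 4 `<=`
    [set u : T | [/\ u 0 0 = 0, u 0 1 = 0, u 0 2 = 0 & u 0 3 = 0]].
  apply: lie_prod_min => [|x y /L3 [x0 x1 x2] _].
    split=> [|a x y /= [x0 x1 x2 x3] [y0 y1 y2 y3]].
      by rewrite /= !testE.
    by rewrite !testE x0 x1 x2 x3 y0 y1 y2 y3 mulr0 addr0.
  by rewrite /= test_lieE !test_lie_rawE x0 x1 x2; split=> //; ring.
apply: lie_prod_min => [|x y /L4 [x0 x1 x2 x3] _].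
  by split=> [|a x y -> ->] //; rewrite /= scaler0 addr0.
rewrite /= test_lieE; apply: testP;
  by rewrite !test_lie_rawE ?testE ?x0 ?x1 ?x2 ?x3; ring.
Qed.

End TestAlgebraSeries.

Lemma test_lcs3 (K : fieldType) : lcs (testAlg (0 : K)) 3 `<=` [set 0].
Proof.
apply: lie_prod_min => [|x y /test_derived [x0 x1] _].
  by split=> [|a x y -> ->] //; rewrite /= scaler0 addr0.
rewrite /= test_lieE; apply: testP;
  by rewrite !test_lie_rawE ?testE ?x0 ?x1; ring.
Qed.

Definition test_basis (K : fieldType) (e : K) (k : 'I_5) : testAlg e :=
  delta_mx 0 k.

Lemma test_basisE (K : fieldType) (e : K) k j :
  (test_basis e k) 0 j = (k == j)%:R.
Proof. by rewrite mxE eqxx eq_sym. Qed.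

Lemma lift_class2 (K : fieldType) m c (g : 'I_m -> testAlg (0 : K)) :
  (2 <= c)%N -> exists2 f : freeMetabNilp K m c -> testAlg (0 : K),
    lie_hom f & forall i, f (fmn_gen K c i) = g i.
Proof.
move=> c2; apply: freeMetabNilp_lift; first exact: test_derived2.
exact: lcs_eq0_le c2 (@test_lcs3 K).
Qed.

Lemma lift_class4 (K : fieldType) m c (g : 'I_m -> testAlg (1 : K)) :
  (4 <= c)%N -> exists2 f : freeMetabNilp K m c -> testAlg (1 : K),
    lie_hom f & forall i, f (fmn_gen K c i) = g i.
Proof.
move=> c4; apply: freeMetabNilp_lift; first exact: test_derived2.
exact: lcs_eq0_le c4 (@test_lcs5 K 1).
Qed.

Lemma test_hom_derived (K : fieldType) (L : lieType K) (e : K)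
    (f : L -> testAlg e) u :
  lie_hom f -> derived L u -> f u 0 0 = 0 /\ f u 0 1 = 0.
Proof.
by move=> hf Du; apply: test_derived; apply: (lie_hom_prod hf (A' := setT)) Du.
Qed.

(** * The action of a normal automorphism on the abelianization *)

Section NormalAut.
Variables (K : fieldType) (m c : nat).
Notation F := (freeMetabNilp K m c).
Notation gen := (@fmn_gen K m c).
Variable phi : F -> F.
Hypothesis nphi : normal_aut F phi.

Let hphi : lie_hom phi := automorphism_hom nphi.1.

(** The set [K x + L'] is an ideal, because brackets land in [L']. *)
Lemma normal_aut_line x : exists a : K, derived F (phi x - a *: x).
Proof.
pose I : set F := [set t | exists a : K, derived F (t - a *: x)].
have sD := derived_subspace F.
suff hI : is_ideal I.
  apply: (normal_aut_mem nphi hI); exists 1.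
  by rewrite scale1r subrr; apply: sD.1.
split; first split=> [|b y z [a Da] [a' Da']].
- by exists 0; rewrite scale0r subr0; apply: sD.1.
- exists (b * a + a'); rewrite scalerDl opprD addrACA -scalerA -scalerBr.
  exact: sD.2.
- by move=> y z _; split; exists 0; rewrite scale0r subr0; apply: derived_lie.
Qed.

(** The scalars of [normal_aut_line] agree on two generators because both agree
    with the scalar of their sum. *)
Lemma normal_aut_scalar : (2 <= m)%N -> (2 <= c)%N ->
  exists a : K, forall i, derived F (phi (gen i) - a *: gen i).
Proof.
move=> m2 c2; pose i0 := Ordinal (ltnW m2).
have [a Da] := normal_aut_line (gen i0); exists a => i.
have [->//|ii0] := eqVneq i i0.
have [b Db] := normal_aut_line (gen i).
have [d Dd] := normal_aut_line (gen i0 + gen i).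
(* On combinations of [gen i0] and [gen i], the first two coordinates of [f]
   are the two coefficients modulo [L']. *)
have [f hf fg] := lift_class2
  (fun j => test_basis 0 (if j == i0 then 0 else 1) : testAlg (0 : K)) c2.
suff -> : a = b by [].
have [] := test_hom_derived hf Da; have [] := test_hom_derived hf Db.
have [] := test_hom_derived hf Dd.
rewrite (lie_homD hphi) !(lie_homB hf) !(lie_homZ hf) !(lie_homD hf) !fg eqxx.
rewrite (negbTE ii0).
rewrite !testE !test_basisE /= !(mulr0, mulr1, addr0, add0r, subr0).
move=> d0 d1 b0 /subr0_eq b1 /subr0_eq a0 a1; move: d0 d1.
by rewrite a0 a1 b0 b1 addr0 add0r => /subr0_eq -> /subr0_eq ->.
Qed.

(** * The scalar is one *)

Section Scalar.
Variable a : K.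
Hypothesis Da : forall i, derived F (phi (gen i) - a *: gen i).

(** Otherwise the image of [phi] would lie in [L']. *)
Lemma scalar_neq0 (i : 'I_m) : (2 <= c)%N -> a != 0.
Proof.
move=> c2; apply/eqP=> a0; have [[psi _ phiK] _ _] := nphi.1.
have sD := derived_subspace F.
have Dphi x : derived F (phi x).
  apply: (@freeMetabNilp_span K m c (phi @^-1` derived F)) => [||j].
  - exact: preimage_subspace.
  - exact: lie_hom_prod.
  - by have := Da j; rewrite a0 scale0r subr0.
have [f hf fg] := lift_class2
  (fun _ : 'I_m => test_basis 0 0 : testAlg (0 : K)) c2.
have [] := test_hom_derived hf (Dphi (psi (gen i))).
by rewrite phiK fg test_basisE eqxx => /eqP; rewrite oner_eq0.
Qed.

Lemma scalar1_IA : a = 1 -> IA_aut F phi.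
Proof.
move=> a1; split; first exact: nphi.1.
have sD := derived_subspace F.
pose S : set F := [set x | derived F (phi x - x)].
apply: (@freeMetabNilp_span K m c S) => [|x Dx|i]; rewrite /S /=.
- split=> [|b x y /= Dx Dy]; first by rewrite /= (lie_hom0 hphi) subr0;
    apply: sD.1.
  by rewrite hphi.1 opprD addrACA -scalerBr; apply: sD.2.
- apply: (subspaceD sD) (subspaceN sD Dx).
  exact: (lie_hom_prod hphi (B' := setT) _ _ Dx).
- by have := Da i; rewrite a1 scale1r.
Qed.

(** The relation [y_0 = - (y_1, y_2)] equates a term scaled by [a] with a term
    scaled by [a ^+ 2] in the Heisenberg algebra. *)
Lemma scalar_eq1_3gen : (3 <= m)%N -> (2 <= c)%N -> a = 1.
Proof.
move=> m3 c2.
pose i0 := Ordinal (ltnW (ltnW m3)); pose i1 := Ordinal (ltnW m3).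
pose i2 := Ordinal m3.
pose g (b : bool) (j : 'I_m) : testAlg (0 : K) :=
  if j == i0 then - b%:R *: test_basis 0 2 else
  if j == i1 then test_basis 0 0 else test_basis 0 1.
have [f hf fg] := lift_class2 (g true) c2.
have [f0 hf0 f0g] := lift_class2 (g false) c2.
(* The two maps differ by the central element [w] on the generators, so they
   take the same value on every bracket. *)
have ff0 x : derived F x -> f x = f0 x.
  have low y : f y 0 0 = f0 y 0 0 /\ f y 0 1 = f0 y 0 1.
    pose S : set F := [set y | f y 0 0 = f0 y 0 0 /\ f y 0 1 = f0 y 0 1].
    apply: (@freeMetabNilp_span K m c S) => [|z Dz|j].
    - split=> [|b z t [z0 z1] [t0 t1]].
        by rewrite /S /= (lie_hom0 hf) (lie_hom0 hf0).
      by rewrite /S /= hf.1 hf0.1 !testE z0 z1 t0 t1.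
    - have [z0 z1] := test_hom_derived hf Dz.
      by have [] := test_hom_derived hf0 Dz; rewrite /S /= z0 z1 => -> ->.
    - rewrite /S /= fg f0g /g; case: ifP => // _.
      by rewrite !testE !test_basisE !mulr0.
  apply: (lie_prod_min (C := [set x | f x = f0 x])) => [|y z _ _].
    by split=> [|b y z /= fy fz]; rewrite /= ?(lie_hom0 hf, lie_hom0 hf0) //
      hf.1 hf0.1 fy fz.
  rewrite /= (lie_hom_lie hf) (lie_hom_lie hf0) !test_lieE.
  by apply: testP; rewrite !test_lie_rawE; have [y0 y1] := low y;
    have [z0 z1] := low z; rewrite ?y0 ?y1 ?z0 ?z1 ?mul0r.
have k0 : f0 (phi (gen i0)) = 0.
  apply: (normal_aut_mem nphi (ker_ideal hf0)).
  by rewrite /= f0g /g eqxx oppr0 scale0r.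
have k : f (phi (gen i0 + lie (gen i1) (gen i2))) = 0.
  apply: (normal_aut_mem nphi (ker_ideal hf)).
  rewrite /= (lie_homD hf) (lie_hom_lie hf) !fg /g /= test_lieE.
  by apply: testP; rewrite !testE !test_lie_rawE !test_basisE /=; ring.
(* The kernel of [f0] contains [gen i0], which removes the contribution of the
   part of [phi (gen i0)] in [L']. *)
have fi0 : f (phi (gen i0)) 0 2 = - a.
  have := ff0 _ (Da i0).
  rewrite !(lie_homB hf, lie_homB hf0) !(lie_homZ hf, lie_homZ hf0) k0.
  rewrite fg f0g /g eqxx.
  move/(congr1 (fun u : testAlg (0 : K) => u 0 2)).
  rewrite !testE !test_basisE /= !mulr1 mulrN1 opprK oppr0 mulr0 subr0.
  by move/eqP; rewrite addr_eq0 => /eqP.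
have [p0 p1] := test_hom_derived hf (Da i1).
have [q0 q1] := test_hom_derived hf (Da i2).
move: p0 p1 q0 q1; rewrite !(lie_homB hf) !(lie_homZ hf) !fg /g /= !testE.
rewrite !test_basisE /= => p0 p1 q0 q1.
have /eqP : a * (a - 1) = 0.
  move/(congr1 (fun u : testAlg (0 : K) => u 0 2)): k.
  rewrite !(lie_homD hphi, lie_hom_lie hphi) !(lie_homD hf, lie_hom_lie hf).
  rewrite test_lieE !testE test_lie_rawE fi0.
  move: p0 p1 q0 q1; rewrite !mulr0 !mulr1 !subr0.
  by move=> /subr0_eq -> -> -> /subr0_eq -> <-; ring.
rewrite mulf_eq0 (negbTE (scalar_neq0 i0 c2)) /= => /eqP; exact: subr0_eq.
Qed.

(** The relation (w, x) = - ((w, y), y), with [w = (x, y)], equates a term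
    scaled by [a ^+ 3] with a term scaled by [a ^+ 4]. *)
Lemma scalar_eq1_2gen : (2 <= m)%N -> (4 <= c)%N -> a = 1.
Proof.
move=> m2 c4; pose i0 := Ordinal (ltnW m2); pose i1 := Ordinal m2.
have [f hf fg] := lift_class4
  (fun j => test_basis 1 (if j == i0 then 0 else 1) : testAlg (1 : K)) c4.
pose z : F := lie (lie (gen i0) (gen i1)) (gen i0) +
  lie (lie (lie (gen i0) (gen i1)) (gen i1)) (gen i1).
have k : f (phi z) = 0.
  apply: (normal_aut_mem nphi (ker_ideal hf)).
  rewrite /= (lie_homD hf) !(lie_hom_lie hf) !fg /= !test_lieE.
  by apply: testP; rewrite !testE !test_lie_rawE ?test_basisE /=; ring.
have [p0 p1] := test_hom_derived hf (Da i0).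
have [q0 q1] := test_hom_derived hf (Da i1).
move: p0 p1 q0 q1; rewrite !(lie_homB hf) !(lie_homZ hf) !fg /= !testE.
rewrite !test_basisE /= !mulr0 !mulr1 !subr0 => /subr0_eq p0 p1 q0 /subr0_eq q1.
have /eqP : a ^+ 3 * (a - 1) = 0.
  move/(congr1 (fun u : testAlg (1 : K) => u 0 4)): k.
  rewrite !(lie_homD hphi, lie_hom_lie hphi) !(lie_homD hf, lie_hom_lie hf).
  rewrite !test_lieE !testE !test_lie_rawE.
  by rewrite p0 p1 q0 q1 => <-; ring.
rewrite mulf_eq0 expf_eq0 /= (negbTE (scalar_neq0 i0 (ltnW (ltnW c4)))) /=.
by move/eqP; apply: subr0_eq.
Qed.

End Scalar.

Lemma normal_aut_IA : (2 <= m)%N -> (2 <= c)%N -> (3 <= m)%N || (4 <= c)%N ->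
  IA_aut F phi.
Proof.
move=> m2 c2 mc; have [a Da] := normal_aut_scalar m2 c2.
apply: (scalar1_IA Da); case/orP: mc => [m3|c4].
  exact: scalar_eq1_3gen Da m3 c2.
exact: scalar_eq1_2gen Da m2 c4.
Qed.

End NormalAut.

Theorem lemma1p8 (K : fieldType) (charK0 : [pchar K] =i pred0) :
  [/\ forall m : nat, (3 <= m)%N ->
        normal_aut (freeMetabNilp K m 2) `<=` IA_aut (freeMetabNilp K m 2),
      forall m : nat, (3 <= m)%N ->
        normal_aut (freeMetabNilp K m 3) `<=` IA_aut (freeMetabNilp K m 3)
    & forall m c : nat, (2 <= m)%N -> (4 <= c)%N ->
        normal_aut (freeMetabNilp K m c) `<=` IA_aut (freeMetabNilp K m c)].
Proof.
split=> [m m3|m m3|m c m2 c4] phi nphi; apply: normal_aut_IA => //.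
- exact: ltnW.
- by rewrite m3.
- exact: ltnW.
- by rewrite m3.
- exact: ltnW (ltnW c4).
- by rewrite c4 orbT.
Qed.
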